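(* Let $g:\mathbb{N}\to\mathbb{C}$ be a totally multiplicative arithmetic function, i.e. $g(rs)=g(r)g(s)$ for all positive integers $r,s$, and for real $x$ put $M(g,x)=\sum_{1\le n\le x}\mu(n)g(n)$, where $\mu$ is the M\''obius function. Let $d\ge 2$ be an integer, let $N_1,\ldots,N_d$ be positive integers, and let $K$ be a positive integer with $K<(1+N_1)(1+N_2)\cdots(1+N_d)$. For a word $V=v_1v_2\cdots v_d\in\{0,1\}^d$ let $w(V)=v_1+\cdots+v_d$ be its weight, and let $\sum_1^1(V)$ denote summation over integers $n_1,\ldots,n_d$ where $n_i=1$ (fixed) if $v_i=0$, and $n_i$ runs over $1,2,\ldots,N_i$ if $v_i=1$. Then $$ M(g,K)=\sum_{i=1}^d M\bigl(g,\min\{N_i,K\}\bigr)\;-\;\sum_{V\in\{0,1\}^d\,:\,w(V)\ge 2}(-1)^{w(V)}\sum_1^1(V)\;\sum_{\substack{k_1,\ldots,k_{w(V)-1}\ge 1\\ k_1k_2\cdots k_{w(V)-1}\le K/(n_1n_2\cdots n_d)}} g\bigl(k_1\cdots k_{w(V)-1}\bigr)\prod_{i=1}^d\mu(n_i)g(n_i), $$ where the innermost sum is over all $(w(V)-1)$-tuples of positive integers $k_1,\ldots,k_{w(V)-1}$ whose product is at most $K/(n_1n_2\cdots n_d)$.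
   Context: $\mu$ denotes the number-theoretic M\''obius function: $\mu(n)=(-1)^\nu$ if $n$ is a product of $\nu$ distinct primes, and $\mu(n)=0$ if $n$ has a repeated prime factor; $\mu(1)=1$. *)

(* Defs.v *)
From mathcomp Require Import all_boot all_order all_algebra.
From mathcomp Require Import reals complex.

Set Implicit Arguments.
Unset Strict Implicit.
Unset Printing Implicit Defensive.

Import Order.TTheory GRing.Theory Num.Theory.

Local Open Scope ring_scope.

Definition moebius (n : nat) : int :=
  if (0 < n)%N && all (fun p => logn p n == 1%N) (primes n)
  then (-1) ^+ size (primes n) else 0.

Definition totally_multiplicative (R : realType) (g : nat -> R[i]) : Prop :=
  forall r s : nat, (0 < r)%N -> (0 < s)%N -> g (r * s)%N = g r * g s.

(* Num.truncn x is the floor of x for x >= 0, and 0 for x < 0. *)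
Definition mertens (R : realType) (g : nat -> R[i]) (x : R) : R[i] :=
  \sum_(1 <= n < (Num.truncn x).+1) (moebius n)%:~R * g n.

Definition weight (d : nat) (V : {ffun 'I_d -> bool}) : nat :=
  (\sum_(i < d) V i)%N.

(* The ordinal bound max N_i only makes the index type finite; the actual
   constraints on n are those of this predicate. *)
Definition word_range (d : nat) (N : 'I_d -> nat) (V : {ffun 'I_d -> bool})
    (n : {ffun 'I_d -> 'I_(\max_(i < d) N i).+1}) : bool :=
  [forall i, if V i then (1 <= n i <= N i)%N else n i == 1%N :> nat].

(* Positive integers with product at most x are all at most x, so bounding
   the entries by the truncation of x loses no tuple. *)
Definition sum_prod_le (R : realType) (g : nat -> R[i]) (m : nat) (x : R) :
    R[i] :=
  \sum_(k : {ffun 'I_m -> 'I_(Num.truncn x).+1} |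
          [forall j, (1 <= k j)%N] && ((\prod_(j < m) k j)%N%:R <= x))
    g (\prod_(j < m) k j)%N.

(* Main.v *)
(** The truncated matrices [dilation_mx n] ([e_i |-> e_(i n)], zero past K)
multiply like the integers and vanish for [n > K], so finite sums of
[twisted n := g n *: dilation_mx n] are Dirichlet series modulo terms of index
larger than [K], and [coef_sum] reads off the sum of the coefficients up to
[K]. Let [G] and [M] be the sums of [twisted n] and of [mu(n) *: twisted n],
and [P_i] the part of [M] with [n <= N_i]. Then [G M = 1], while
[\prod_i (M - P_i) = 0] because [\prod_i (1 + N_i) > K]. Hence
[M \prod_i (1 - G P_i) = 0]; expanding the product over words [V] and using
[M G = 1] gives the identity between matrices whose [coef_sum] is the theorem.
The one degenerate case is [g 1 = 0], where [g] vanishes on all [n > 0]. *)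

Require Import Defs.
From HB Require Import structures.
From mathcomp Require Import all_boot all_order all_algebra.
From mathcomp Require Import reals complex.
Set Implicit Arguments.
Unset Strict Implicit.
Unset Printing Implicit Defensive.
Import Order.TTheory GRing.Theory Num.Theory.
Local Open Scope ring_scope.

Lemma sum_multiples (V : zmodType) (H : nat -> V) (B a : nat) :
    (0 < a)%N -> (forall n, (B <= n)%N -> H n = 0) ->
  \sum_(b < B) H (a * b)%N = \sum_(n < B | (a %| n)%N) H n.
Proof.
move=> a0 HB.
transitivity (\sum_(b < B) \sum_(n < B | n == (a * b)%N :> nat) H n).
  apply: eq_bigr => b _; have [lt|ge] := ltnP (a * b) B.
    by rewrite (big_pred1 (Ordinal lt)) // => n; rewrite -val_eqE.
  rewrite HB // big_pred0 // => n; apply/eqP => E.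
  by move: (ltn_ord n); rewrite E ltnNge ge.
rewrite (exchange_big_dep xpredT) //= [RHS]big_mkcond; apply: eq_bigr => n _.
case: ifPn => [/dvdnP[q nq]|ndiv]; last first.
  by rewrite big_pred0 // => b; apply/eqP => E; rewrite E dvdn_mulr in ndiv.
have qB : (q < B)%N.
  by apply: leq_ltn_trans (ltn_ord n); rewrite nq leq_pmulr.
rewrite (big_pred1 (Ordinal qB)) // => b.
by rewrite nq mulnC eqn_pmul2l // eq_sym -val_eqE.
Qed.

Lemma moebius0 : moebius 0 = 0. Proof. by []. Qed.

Lemma moebius1 : moebius 1 = 1. Proof. by []. Qed.

Lemma moebius_prime_mul_dvd (p b : nat) :
  prime p -> (p %| b)%N -> moebius (p * b) = 0.
Proof.
move=> pp pb; rewrite /moebius; case: (posnP b) => [->|b0]; first by rewrite muln0.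
case: ifP => // /andP[_ /allP/(_ p)].
rewrite mem_primes pp muln_gt0 prime_gt0 // b0 dvdn_mulr // => /(_ isT).
rewrite lognM ?(prime_gt0 pp) // logn_prime // eqxx add1n eqSS => /eqP l0.
by have := pb; rewrite -[p in (p %| _)%N]expn1 pfactor_dvdn // l0.
Qed.

Lemma moebius_prime_mul_ndvd (p b : nat) :
  prime p -> ~~ (p %| b)%N -> moebius (p * b) = - moebius b.
Proof.
move=> pp npb; case: (posnP b) npb => [->|b0 npb]; first by rewrite dvdn0.
have p0 := prime_gt0 pp.
have perm : perm_eq (primes (p * b)) (p :: primes b).
  apply: uniq_perm; first exact: primes_uniq.
    by rewrite /= primes_uniq andbT mem_primes pp b0.
  by move=> q; rewrite primesM // primes_prime // !inE.
rewrite /moebius muln_gt0 p0 b0 (perm_all _ perm) (perm_size perm) /=.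
rewrite lognM // logn_prime // eqxx.
have -> : logn p b = 0%N.
  by apply/eqP; rewrite -leqn0 leqNgt logn_gt0 mem_primes pp b0.
rewrite /= (eq_in_all (a2 := fun q => logn q b == 1%N)) => [|q qb]; last first.
  rewrite lognM // logn_prime //; case: (eqVneq q p) => // qp.
  by move: qb npb; rewrite qp mem_primes => /and3P[_ _ ->].
by case: ifP; rewrite ?oppr0 // exprS mulN1r.
Qed.

Lemma sum_moebius_dvd (B n : nat) : (0 < n < B)%N ->
  \sum_(a < B | (a %| n)%N) moebius a = (n == 1%N)%:R.
Proof.
case/andP=> n0 nB; have [n1|n1] := eqVneq n 1%N.
  have B1 : (1 < B)%N by rewrite -n1.
  by rewrite (big_pred1 (Ordinal B1)) // => a; rewrite n1 dvdn1.
have n_gt1 : (1 < n)%N by rewrite ltn_neqAle eq_sym n1.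
pose p := pdiv n; have pp : prime p by exact: pdiv_prime.
pose H a := if (a %| n)%N then moebius a else 0.
have HB a : (B <= a)%N -> H a = 0.
  move=> Ba; rewrite /H; case: ifP => // /(dvdn_leq n0) an.
  by have := leq_ltn_trans an nB; rewrite ltnNge Ba.
rewrite big_mkcond -/(H _) (bigID (fun a : 'I_B => (p %| a)%N)) /=.
rewrite -(sum_multiples (prime_gt0 pp) HB) [X in _ + X]big_mkcond -big_split /=.
apply: big1 => b _; rewrite /H; case: (boolP (p %| b)%N) => /= pb.
  by rewrite addr0; case: ifP; rewrite ?moebius_prime_mul_dvd.
rewrite Gauss_dvd ?prime_coprime // pdiv_dvd /= moebius_prime_mul_ndvd //.
by case: ifP; rewrite ?addNr ?addr0.
Qed.

Lemma prod_exp_comm (A : nzRingType) d (x : A) (c : 'I_d -> nat) (F : 'I_d -> A) :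
    (forall i, GRing.comm x (F i)) ->
  \prod_(i < d) (x ^+ c i * F i) = x ^+ (\sum_(i < d) c i)%N * \prod_(i < d) F i.
Proof.
move=> xF; elim: d c F xF => [|d IH] c F xF; first by rewrite !big_ord0 mulr1.
rewrite !big_ord_recl IH // exprD !mulrA; congr (_ * _).
rewrite -!mulrA; congr (_ * _).
by apply: commrX; exact: commr_sym.
Qed.

Lemma weight_delta d (i : 'I_d) : weight [ffun j => j == i] = 1%N.
Proof.
rewrite /weight (bigD1 i) //= ffunE eqxx big1 // => j /negPf ji.
by rewrite ffunE ji.
Qed.

Lemma weight_eq0 d (V : {ffun 'I_d -> bool}) :
  (weight V == 0%N) = (V == [ffun=> false]).
Proof.
rewrite /weight sum_nat_eq0; apply/forallP/eqP => [V0|-> i]; last by rewrite ffunE.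
by apply/ffunP => i; rewrite ffunE; have := V0 i; case: (V i).
Qed.

Lemma sum_weight1 (A : zmodType) d (F : {ffun 'I_d -> bool} -> A) :
  \sum_(V | weight V == 1%N) F V = \sum_(i < d) F [ffun j => j == i].
Proof.
pose delta (i : 'I_d) := [ffun j : 'I_d => j == i].
have delta_inj : injective delta.
  by move=> i j /ffunP/(_ i); rewrite !ffunE eqxx => /esym/eqP.
transitivity (\sum_(V in delta @: [set: 'I_d]) F V); last first.
  rewrite big_imset /= => [|i j _ _]; last exact: delta_inj.
  by apply: eq_bigl => i; rewrite inE.
apply: eq_bigl => V; apply/eqP/imsetP => [w1|[i _ ->]]; last exact: weight_delta.
have [i Vi] : exists i, V i.
  apply/existsP; apply: contraPT w1 => /existsPn V0.
  by rewrite /weight big1 // => i _; rewrite (negPf (V0 i)).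
exists i => //; apply/ffunP => j; rewrite ffunE.
have [->//|ji] := eqVneq j i.
apply/negbTE/negP => Vj; move: w1.
by rewrite /weight (bigD1 i) //= (bigD1 j) //= Vi Vj.
Qed.

Section TruncatedDirichlet.

Variables (C : comNzRingType) (k : nat) (g : nat -> C).
Local Notation K := k.+1.

(* Row and column indices 0, ..., k stand for the integers 1, ..., K. *)
Definition dilation_mx (n : nat) : 'M[C]_K :=
  \matrix_(i, j) (i.+1 * n == j.+1)%N%:R.

Lemma dilation_mx1 : dilation_mx 1 = 1.
Proof. by apply/matrixP=> i j; rewrite !mxE muln1 eqSS. Qed.

Lemma dilation_mx0 : dilation_mx 0 = 0.
Proof. by apply/matrixP=> i j; rewrite !mxE muln0. Qed.

Lemma dilation_mx_eq0 n : (K < n)%N -> dilation_mx n = 0.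
Proof.
move=> Kn; apply/matrixP=> i j; rewrite !mxE; case: eqP => // E.
have := leq_trans Kn (leq_pmull n (ltn0Sn i)).
by rewrite E ltnNge ltn_ord.
Qed.

Lemma dilation_mxM a b : dilation_mx (a * b) = dilation_mx a * dilation_mx b.
Proof.
apply/matrixP=> i j; rewrite !mxE.
under eq_bigr => l _ do rewrite !mxE.
have [->|b0] := posnP b.
  by rewrite !muln0 big1 // => l _; rewrite muln0 mulr0.
have [->|a0] := posnP a.
  by rewrite mul0n muln0 big1 // => l _; rewrite mul0r.
have [lt|ge] := ltnP (i.+1 * a).-1 K.
  rewrite (bigD1 (Ordinal lt)) //= prednK ?muln_gt0 ?a0 // eqxx mul1r mulnA.
  rewrite big1 ?addr0 // => l /eqP ne; case: eqP => [E|]; last by rewrite mul0r.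
  by case: ne; apply/val_inj; rewrite /= E.
rewrite big1 => [|l _]; last first.
  case: eqP => [E|]; last by rewrite mul0r.
  by move: ge; rewrite E /= leqNgt ltn_ord.
case: eqP => // E; move: ge; rewrite leqNgt => /negP[].
rewrite prednK ?muln_gt0 ?a0 //; apply: leq_trans (ltn_ord j).
by rewrite -E mulnA leq_pmulr.
Qed.

Hypothesis g1 : g 1 = 1.
Hypothesis gM : forall r s, (0 < r)%N -> (0 < s)%N -> g (r * s)%N = g r * g s.

Lemma mult_prod (I : finType) (f : I -> nat) :
  (forall i, 0 < f i)%N -> g (\prod_i f i)%N = \prod_i g (f i).
Proof.
move=> f0; suff [] : (0 < \prod_i f i)%N /\ g (\prod_i f i)%N = \prod_i g (f i) by [].
elim/big_rec2: _ => // i y x _ [x0 E]; by rewrite muln_gt0 f0 x0 gM // E.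
Qed.

Definition twisted (n : nat) : 'M[C]_K := g n *: dilation_mx n.

Lemma twisted1 : twisted 1 = 1.
Proof. by rewrite /twisted g1 scale1r dilation_mx1. Qed.

Lemma twisted0 : twisted 0 = 0.
Proof. by rewrite /twisted dilation_mx0 scaler0. Qed.

Lemma twisted_eq0 n : (K < n)%N -> twisted n = 0.
Proof. by move=> Kn; rewrite /twisted dilation_mx_eq0 ?scaler0. Qed.

Lemma twistedM a b : twisted (a * b) = twisted a * twisted b.
Proof.
have [->|a0] := posnP a; first by rewrite mul0n twisted0 mul0r.
have [->|b0] := posnP b; first by rewrite muln0 twisted0 mulr0.
by rewrite /twisted gM // dilation_mxM -scalerAl -scalerAr scalerA.
Qed.

Lemma prod_scale_twisted (I : finType) (c : I -> C) (f : I -> nat) :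
  \prod_i (c i *: twisted (f i)) = (\prod_i c i) *: twisted (\prod_i f i).
Proof.
elim/big_rec3: _ => [|i x y z _ ->]; first by rewrite twisted1 scale1r.
by rewrite twistedM -scalerAl -scalerAr scalerA.
Qed.

Definition zeta_part (B : nat) : 'M[C]_K := \sum_(n < B.+1) twisted n.

Definition moebius_part (B : nat) : 'M[C]_K :=
  \sum_(n < K.+1 | (n <= B)%N) (moebius n)%:~R *: twisted n.

Lemma zeta_moebius : zeta_part K * moebius_part K = 1.
Proof.
rewrite /zeta_part /moebius_part mulr_suml.
under eq_bigr do rewrite mulr_sumr.
rewrite exchange_big /=.
transitivity (\sum_(a < K.+1) \sum_(n < K.+1 | (a %| n)%N) (moebius a)%:~R *: twisted n).
  rewrite big_mkcond; apply: eq_bigr => a _; rewrite -ltnS ltn_ord.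
  have [->|a0] := posnP a.
    by rewrite !big1 // => b _; rewrite moebius0 scale0r ?mulr0.
  rewrite -(@sum_multiples _ (fun n => (moebius a)%:~R *: twisted n)) //.
    apply: eq_bigr => b _; by rewrite mulnC twistedM scalerAr.
  by move=> n Kn; rewrite twisted_eq0 ?scaler0.
rewrite (exchange_big_dep xpredT) //=.
have lt1 : (1 < K.+1)%N by [].
rewrite (bigD1 (Ordinal lt1)) //= -scaler_suml twisted1 -mulrz_sumr.
rewrite sum_moebius_dvd // scale1r big1 ?addr0 // => n.
rewrite -val_eqE /= => n1; have [->|n0] := posnP n.
  by rewrite twisted0 big1 // => i _; rewrite scaler0.
by rewrite -scaler_suml -mulrz_sumr sum_moebius_dvd ?n0 ?ltn_ord // (negPf n1) scale0r.
Qed.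

Lemma twisted_comm a b : GRing.comm (twisted a) (twisted b).
Proof. by rewrite /GRing.comm -!twistedM mulnC. Qed.

Lemma zeta_part_comm B a : GRing.comm (zeta_part B) (twisted a).
Proof. by apply/commr_sym/commr_sum => n _; exact: twisted_comm. Qed.

Lemma zeta_moebius_comm B N : GRing.comm (zeta_part B) (moebius_part N).
Proof.
apply: commr_sum => n _.
by rewrite /GRing.comm -scalerAl -scalerAr zeta_part_comm.
Qed.

Lemma prod_moebius_tail d (N : 'I_d -> nat) : (K < \prod_(i < d) (1 + N i))%N ->
  \prod_(i < d) (moebius_part K - moebius_part (N i)) = 0.
Proof.
move=> hK.
under eq_bigr => i _.
  have -> : moebius_part K - moebius_part (N i) =
     \sum_(n < K.+1 | ~~ (n <= N i)%N) (moebius n)%:~R *: twisted n.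
    have -> : moebius_part K = \sum_(n < K.+1) (moebius n)%:~R *: twisted n.
      by apply: eq_bigl => n; rewrite -ltnS ltn_ord.
    by rewrite (bigID (fun n : 'I__ => (n <= N i)%N)) /= addrAC subrr add0r.
  over.
rewrite bigA_distr_big_dep big1 // => f /familyP fN.
rewrite prod_scale_twisted twisted_eq0 ?scaler0 //.
apply: leq_trans hK _; apply: leq_prod => i _.
by have := fN i; rewrite unfold_in -ltnNge add1n.
Qed.

Lemma moebius_part_expansion d (N : 'I_d -> nat) :
    (K < \prod_(i < d) (1 + N i))%N ->
  moebius_part K = \sum_(i < d) moebius_part (N i) -
    \sum_(V : {ffun 'I_d -> bool} | (2 <= weight V)%N)
      (-1) ^+ weight V *: (zeta_part K ^+ (weight V).-1 *
        \prod_(i < d) (if V i then moebius_part (N i) else 1)).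
Proof.
move=> hK; set G := zeta_part K; set M := moebius_part K.
have GM : G * M = 1 := zeta_moebius.
have MG : M * G = 1 by rewrite -(zeta_moebius_comm K K).
pose Q (V : {ffun 'I_d -> bool}) i := if V i then moebius_part (N i) else 1.
have : M * \prod_(i < d) (1 - G * moebius_part (N i)) = 0.
  under eq_bigr => i _.
    rewrite -GM -mulrBr -[G in G * _]expr1; over.
  rewrite (@prod_exp_comm _ _ G (fun=> 1%N)); last first.
    by move=> i; apply: commrB; exact: zeta_moebius_comm.
  by rewrite prod_moebius_tail // !mulr0.
under eq_bigr => i _.
  have -> : 1 - G * moebius_part (N i) =
     \sum_(b : bool) (if b then (- G) * moebius_part (N i) else 1).
    by rewrite big_bool addrC mulNr.
  over.
rewrite bigA_distr_bigA mulr_sumr.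
under eq_bigr => V _.
  have -> : \prod_(i < d) (if V i then (- G) * moebius_part (N i) else 1) =
     (- G) ^+ weight V * \prod_(i < d) Q V i.
    rewrite -prod_exp_comm => [|i]; last first.
      rewrite /Q; case: ifP => _; last exact: commr1.
      by apply/commr_sym/commrN/commr_sym; exact: zeta_moebius_comm.
    by apply: eq_bigr => i _; rewrite /Q; case: (V i); rewrite ?expr1 ?expr0 ?mulr1.
  over.
have MGw V : (0 < weight V)%N ->
    M * ((- G) ^+ weight V * \prod_(i < d) Q V i) =
    (-1) ^+ weight V *: (G ^+ (weight V).-1 * \prod_(i < d) Q V i).
  case: (weight V) => // w _.
  by rewrite -[- G]scaleN1r exprZn -scalerAl -scalerAr [G ^+ _.+1]exprS !mulrA MG mul1r.
rewrite (bigID (fun V => 2 <= weight V)%N) /=.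
rewrite [X in _ + X](bigD1 [ffun=> false]) /=; last first.
  by rewrite (eqP (_ : weight _ == 0%N)) ?weight_eq0.
rewrite (eqP (_ : weight [ffun=> false] == 0%N)) ?weight_eq0 // expr0 mul1r.
rewrite [\prod_(i < d) Q _ i]big1 ?mulr1 => [|i _]; last by rewrite /Q ffunE.
rewrite [X in _ + (_ + X)](eq_bigl (fun V => weight V == 1%N)) => [|V]; last first.
  rewrite -weight_eq0; by case: (weight V) => [|[|]].
rewrite sum_weight1.
under eq_bigr => V w2 do rewrite MGw ?(ltnW w2) //.
rewrite [X in _ + (_ + X)](eq_bigr (fun i => - moebius_part (N i))); last first.
  move=> i _; rewrite MGw weight_delta // expr0 mul1r expr1 scaleN1r.
  rewrite (eq_bigr (fun j => if j == i then moebius_part (N j) else 1)) => [|j _].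
    by rewrite -big_mkcond big_pred1_eq.
  by rewrite /Q ffunE.
rewrite sumrN addrC => /eqP; rewrite addr_eq0 => /eqP E.
by rewrite -(subrK (\sum_(i < d) moebius_part (N i)) M) E addrC.
Qed.

Definition coef_sum (A : 'M[C]_K) : C := \sum_j A ord0 j.

Lemma coef_sum_is_scalar : scalar coef_sum.
Proof.
move=> c A B; rewrite /coef_sum mulr_sumr -big_split.
by apply: eq_bigr => j _; rewrite !mxE.
Qed.

HB.instance Definition _ :=
  GRing.isLinear.Build C 'M[C]_K C *%R coef_sum coef_sum_is_scalar.

Lemma coef_sum_twisted n :
  coef_sum (twisted n) = if (1 <= n <= K)%N then g n else 0.
Proof.
rewrite /coef_sum; case: n => [|n] /=.
  by rewrite twisted0 big1 // => j _; rewrite mxE.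
case: ifP => nK; last first.
  rewrite twisted_eq0; last by rewrite ltnNge nK.
  by rewrite big1 // => j _; rewrite mxE.
rewrite (bigD1 (Ordinal nK)) //= !mxE mul1n eqxx mulr1 big1 ?addr0 // => j jn.
rewrite !mxE mul1n eqSS; case: eqP => [E|]; last by rewrite mulr0.
by case/eqP: jn; apply/val_inj.
Qed.

Lemma zeta_part_twisted a : (0 < a)%N ->
  zeta_part K * twisted a = zeta_part (K %/ a) * twisted a.
Proof.
move=> a0; rewrite /zeta_part !mulr_suml.
rewrite -!(big_mkord xpredT (fun n => twisted n * twisted a)).
have le : ((K %/ a).+1 <= K.+1)%N by rewrite ltnS leq_div.
rewrite (big_cat_nat (n := (K %/ a).+1)) //=.
rewrite [X in _ + X]big_nat_cond [X in _ + X]big1 ?addr0 // => n.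
rewrite andbT => /andP[an _]; rewrite -twistedM twisted_eq0 //.
by rewrite -ltn_divLR.
Qed.

Lemma zeta_part_exp_twisted m a : (0 < a)%N ->
  zeta_part K ^+ m * twisted a = zeta_part (K %/ a) ^+ m * twisted a.
Proof.
move=> a0; elim: m => [|m IH]; first by rewrite !expr0.
by rewrite !exprSr -!mulrA zeta_part_twisted // zeta_part_comm !mulrA IH.
Qed.

Lemma coef_sum_moebius_part N :
  coef_sum (moebius_part N) =
  \sum_(1 <= n < (minn N K).+1) (moebius n)%:~R * g n.
Proof.
rewrite /moebius_part linear_sum big_geq_mkord /=.
have le : ((minn N K).+1 <= K.+1)%N by rewrite ltnS geq_minr.
rewrite [RHS](big_ord_widen_cond _ (fun n => 1 <= n)%N
  (fun n => (moebius n)%:~R * g n) le).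
rewrite [LHS]big_mkcond [RHS]big_mkcond; apply: eq_bigr => n _.
rewrite linearZ /= coef_sum_twisted ltnS leq_min -(ltnS n K) ltn_ord !andbT.
by case: (1 <= n)%N; case: (n <= N)%N => //=; rewrite mulr0.
Qed.

Lemma sum_moebius_part N B : (N < B)%N ->
  \sum_(n < B | (1 <= n <= N)%N) (moebius n)%:~R *: twisted n = moebius_part N.
Proof.
move=> NB; pose F n := (moebius n)%:~R *: twisted n.
have FK n : (K < n)%N -> F n = 0 by move=> ?; rewrite /F twisted_eq0 ?scaler0.
have cut b c : (b <= c)%N -> (forall n, (b <= n)%N -> (n <= N)%N -> F n = 0) ->
    \sum_(n < b | (n <= N)%N) F n = \sum_(n < c | (n <= N)%N) F n.
  move=> bc Fb; rewrite -!(big_mkord (fun n => n <= N)%N F).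
  rewrite [RHS](big_cat_nat (n := b)) //= [X in _ + X]big_nat_cond.
  by rewrite [X in _ + X]big1 ?addr0 // => n /andP[/andP[? _] ?]; apply: Fb.
transitivity (\sum_(n < B | (n <= N)%N) F n).
  rewrite [LHS]big_mkcond [RHS]big_mkcond; apply: eq_bigr => -[[|n] nB] _ //=.
  by rewrite /F twisted0 scaler0.
have Ntail n : (B <= n)%N -> (n <= N)%N -> F n = 0.
  by move=> Bn nN; have := leq_trans NB Bn; rewrite ltnNge nN.
rewrite (cut _ _ (leq_maxl B K.+1) Ntail) -(cut K.+1) ?leq_maxr // => n Kn _.
exact: FK.
Qed.

End TruncatedDirichlet.

Lemma truncn_nat_div (R : realType) (K a : nat) : (0 < a)%N ->
  Num.truncn (K%:R / a%:R : R) = (K %/ a)%N.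
Proof.
move=> a0; apply: truncn_def.
by rewrite ler_pdivlMr ?ltr_pdivrMr ?ltr0n // -!natrM ler_nat ltr_nat leq_divM ltn_ceil.
Qed.

Lemma coef_sum_zeta_exp (R : realType) (k : nat) (g : nat -> R[i]) (m a : nat) :
    g 1%N = 1 -> totally_multiplicative g -> (0 < a)%N ->
  coef_sum (zeta_part k g k.+1 ^+ m * twisted k g a) =
  sum_prod_le g m (k.+1%:R / a%:R : R) * g a.
Proof.
move=> g1 gM a0; rewrite zeta_part_exp_twisted // /sum_prod_le truncn_nat_div //.
set B := (k.+1 %/ a)%N.
have -> : zeta_part k g B ^+ m = \prod_(j < m) \sum_(n < B.+1) twisted k g n.
  by rewrite prodr_const card_ord.
rewrite bigA_distr_bigA !mulr_suml linear_sum [RHS]big_mkcond.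
apply: eq_bigr => f _ /=.
under eq_bigr => j _ do rewrite -[twisted _ _ _]scale1r.
rewrite prod_scale_twisted // big1 // scale1r -twistedM // coef_sum_twisted.
rewrite ler_pdivlMr ?ltr0n // -natrM ler_nat muln_gt0 a0 andbT.
have -> : (0 < \prod_(j < m) f j)%N = [forall j, 1 <= f j]%N.
  apply/idP/forallP => [f0 j|f0]; last by apply: prodn_gt0.
  by move: f0; rewrite (bigD1 j) //= muln_gt0 => /andP[].
by case: ifP => // /andP[/forallP f0 _]; rewrite gM // prodn_gt0.
Qed.

Lemma mertens_coef_sum (R : realType) (k : nat) (g : nat -> R[i]) (N : nat) :
  mertens g (minn N k.+1)%:R = coef_sum (moebius_part k g N).
Proof. by rewrite coef_sum_moebius_part /mertens natrK. Qed.

Lemma coef_sum_word (R : realType) (k : nat) (g : nat -> R[i]) (d m : nat)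
    (N : 'I_d -> nat) (V : {ffun 'I_d -> bool}) :
    g 1%N = 1 -> totally_multiplicative g -> (forall i, 0 < N i)%N ->
  coef_sum (zeta_part k g k.+1 ^+ m *
    \prod_(i < d) (if V i then moebius_part k g (N i) else 1)) =
  \sum_(n : {ffun 'I_d -> 'I_(\max_(i < d) N i).+1} | word_range V n)
    sum_prod_le g m (k.+1%:R / (\prod_(i < d) n i)%N%:R : R) *
    \prod_(i < d) ((moebius (n i))%:~R * g (n i)).
Proof.
move=> g1 gM hN; set B := (\max_(i < d) N i).+1.
have NB i : (N i < B)%N by rewrite ltnS leq_bigmax.
pose inr i (n : 'I_B) := if V i then (1 <= n <= N i)%N else n == 1%N :> nat.
rewrite (eq_bigr (fun i => \sum_(n | inr i n) (moebius n)%:~R *: twisted k g n));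
    last first.
  move=> i _; rewrite /inr; case: (V i); first by rewrite sum_moebius_part.
  have lt1 : (1 < B)%N by apply: leq_trans (NB i); rewrite ltnS.
  by rewrite (big_pred1 (Ordinal lt1)) // moebius1 scale1r twisted1.
rewrite bigA_distr_big_dep mulr_sumr linear_sum /=; apply: eq_big => [n|n /familyP Vn].
  exact/familyP/forallP.
have n_gt0 i : (0 < n i)%N.
  by have := Vn i; rewrite unfold_in /inr; case: (V i) => [/andP[]|/eqP ->].
rewrite prod_scale_twisted // -scalerAr linearZ /= coef_sum_zeta_exp ?prodn_gt0 //.
by rewrite big_split /= (mult_prod g1 gM) // mulrCA.
Qed.

Lemma totally_multiplicative_1 (R : realType) (g : nat -> R[i]) :
  totally_multiplicative g ->
  g 1%N = 1 \/ forall n, (0 < n)%N -> g n = 0.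
Proof.
move=> gM; have [g10|g1n0] := eqVneq (g 1%N) 0.
  by right=> n n0; rewrite -[n]mul1n gM // g10 mul0r.
by left; apply: (mulfI g1n0); rewrite -gM // mulr1.
Qed.

Theorem theorem1 (R : realType) (g : nat -> R[i])
    (hg : totally_multiplicative g)
    (d : nat) (hd : (2 <= d)%N)
    (N : 'I_d -> nat) (hN : forall i : 'I_d, (0 < N i)%N)
    (K : nat) (hK0 : (0 < K)%N) (hK : (K < \prod_(i < d) (1 + N i))%N) :
  mertens g K%:R =
    \sum_(i < d) mertens g (minn (N i) K)%:R
    - \sum_(V : {ffun 'I_d -> bool} | (2 <= weight V)%N)
        (-1) ^+ weight V *
        \sum_(n : {ffun 'I_d -> 'I_(\max_(i < d) N i).+1} | word_range V n)
          sum_prod_le g (weight V).-1 (K%:R / (\prod_(i < d) n i)%N%:R) *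
          \prod_(i < d) ((moebius (n i))%:~R * g (n i)).
Proof.
have [g1|g0] := totally_multiplicative_1 hg; last first.
  have mertens0 x : mertens g x = 0.
    rewrite /mertens big_nat_cond big1 // => n /andP[/andP[n0 _] _].
    by rewrite g0 // mulr0.
  rewrite mertens0 big1 => [|i _]; last exact: mertens0.
  rewrite sub0r big1 ?oppr0 // => V _; rewrite big1 ?mulr0 // => n /forallP Vn.
  have i : 'I_d by exact: Ordinal hd.
  rewrite [X in _ * X](bigD1 i) //= g0 ?mulr0 ?mul0r ?mulr0 //.
  by have := Vn i; case: (V i) => [/andP[]|/eqP ->].
case: K hK0 hK => // k _ hK.
rewrite -[k.+1 in LHS]minnn mertens_coef_sum (moebius_part_expansion g1 hg hK).
rewrite linearB /=; congr (_ - _); rewrite linear_sum /=.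
  by apply: eq_bigr => i _; rewrite mertens_coef_sum.
by apply: eq_bigr => V _; rewrite linearZ /= coef_sum_word.
Qed.
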